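(* Fix $\nu$ and $\phi$, and let $(\mathbf x,\mathbf s)$ and $(\mathbf x',\mathbf s')$ be two (finite, one-dimensional) voter distributions, each satisfying the wide-support condition. Let $x_m$, $x_m'$ be their medians and $\mathbf x_m$, $\mathbf x'_m$ the constant vectors with all entries $x_m$, $x'_m$. If $(\mathbf x'-\mathbf x'_m,\mathbf s')$ is a spread of $(\mathbf x-\mathbf x_m,\mathbf s)$, then $$\bar x'-\underline x'>\bar x-\underline x\qquad\text{and}\qquad \hat V_p(\mathbf x',\mathbf s')>\hat V_p(\mathbf x,\mathbf s)\quad\text{for } p=A,B,$$ where $\underline x<\bar x$ and $\underline x'<\bar x'$ are the equilibrium platforms under the two electorates and $\hat V_p$ is party $p$'s equilibrium payoff.
   Context: A voter distribution $(\mathbf x,\mathbf s)$ consists of $N\ge2$ voter types with distinct bliss points $x_1<\cdots<x_N$ in $\mathbb R$ and shares $s_i>0$, $\sum_i s_i=1$ ($N$ may differ across distributions). Two parties $A,B$ simultaneously choose platforms in $[x_1,x_N]$. Let $\Delta_i(x_A,x_B)=(x_B-x_i)^2-(x_A-x_i)^2$. A common shock $\epsilon$ is uniform on $[-\phi,\phi]$; the wide-support condition is $\phi>\max_{a,b\in[x_1,x_N],\,i}|\Delta_i(a,b)|$. Vote shares are $S_A(\epsilon)=\sum_i s_i\mathbf 1\{\Delta_i\ge\epsilon\}$, $S_B=1-S_A$. The power rule $\rho:[0,1]\to\mathbb R$ is strictly increasing (possibly discontinuous) with $\rho(s)+\rho(1-s)=\bar\rho$ for all $s$; $U:[\rho(0),\rho(1)]\to\mathbb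 R$ is continuous, strictly increasing, strictly concave; $\nu=U\circ\rho$ with $\nu(1)-\nu(0)=1$. Payoffs are $V_p=\mathbb E_\epsilon[\nu(S_p(\epsilon))]$. Equilibrium facts: put $\underline s_i=\sum_{j\le i}s_j$, $\bar s_i=\sum_{j\ge i}s_j$, $\underline s_0=\bar s_{N+1}=0$, $\underline x=\sum_i[\nu(\underline s_i)-\nu(\underline s_{i-1})]x_i$ and $\bar x=\sum_i[\nu(\bar s_i)-\nu(\bar s_{i+1})]x_i$. Then $\underline x<\bar x$, and the pure-strategy Nash equilibria are exactly $(\bar x,\underline x)$ and $(\underline x,\bar x)$; both parties get the same payoff, denoted $\hat V_p(\mathbf x,\mathbf s)$. Median: $x_m$ is the midpoint of the set of points with at least half of the electorate weakly on either side. Spread: for a voter distribution, split any mass located at the median between two half-electorates (voters at or to the left of the median, and voters at or to the right) so that each has mass $\frac12$; normalize each to unit mass, giving the left distribution $(\mathbf x_L,\mathbf s_L)$ and right distribution $(\mathbf x_R,\mathbf s_R)$. The distribution $(\mathbf x',\mathbf s')$ is a spread of $(\mathbf x,\mathbf s)$ if $(\mathbf x_L,\mathbf s_L)$ first-order stochastically dominates $(\mathbf x_L',\mathbf s_L')$ and $(\mathbf x_R',\mathbf s_R')$ first-order stochastically dominates $(\mathbf x_R,\mathbf s_R)$ (dominance is weak: pointwise ordering of cdfs), with at least one of the two relations strict (the two distributions differ). *)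

(* Defs.v *)
From mathcomp Require Import all_boot all_order all_algebra.
From mathcomp Require Import all_classical all_reals all_analysis.

Set Implicit Arguments.
Unset Strict Implicit.
Unset Printing Implicit Defensive.

Import Order.TTheory GRing.Theory Num.Theory.
Import numFieldNormedType.Exports.

Local Open Scope classical_set_scope.
Local Open Scope ring_scope.

(* The number of types is N = extra_types.+2, so that N >= 2 and the extreme
   bliss points x_1 and x_N are [bliss ord0] and [bliss ord_max]. *)
Record voter_dist (R : realType) := VoterDist {
  extra_types : nat ;
  bliss : 'I_extra_types.+2 -> R ;
  share : 'I_extra_types.+2 -> R ;
  bliss_incr : forall i j : 'I_extra_types.+2, (i < j)%N -> bliss i < bliss j ;
  share_gt0 : forall i, 0 < share i ;
  share_sum1 : \sum_i share i = 1
}.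

Arguments bliss {R} _ _.
Arguments share {R} _ _.
Arguments share_gt0 {R} _ _.

Lemma translate_incr (R : realType) (D : voter_dist R) (c : R)
    (i j : 'I_(extra_types D).+2) :
  (i < j)%N -> bliss D i - c < bliss D j - c.
Proof. by move=> ij; rewrite ltrD2r; exact: bliss_incr. Qed.

Definition translate (R : realType) (D : voter_dist R) (c : R) : voter_dist R :=
  VoterDist (@translate_incr R D c) (share_gt0 D) (share_sum1 D).

Definition platforms (R : realType) (D : voter_dist R) : set R :=
  `[bliss D ord0, bliss D ord_max].

Definition Delta (R : realType) (D : voter_dist R)
    (i : 'I_(extra_types D).+2) (xA xB : R) : R :=
  (xB - bliss D i) ^+ 2 - (xA - bliss D i) ^+ 2.

Arguments Delta {R} D i xA xB.

(* phi exceeds the (attained) maximum of |Delta_i(a, b)|. *)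
Definition wide_support (R : realType) (D : voter_dist R) (phi : R) : Prop :=
  forall (a b : R) (i : 'I_(extra_types D).+2),
    platforms D a -> platforms D b -> `|Delta D i a b| < phi.

Inductive party := PartyA | PartyB.

Definition vote_share (R : realType) (D : voter_dist R) (p : party)
    (xA xB eps : R) : R :=
  let SA := \sum_(i | eps <= Delta D i xA xB) share D i in
  match p with PartyA => SA | PartyB => 1 - SA end.

(* Only the values of rho on [0, 1] matter. *)
Definition power_rule (R : realType) (rho : R -> R) (rhobar : R) : Prop :=
  {in `[0, 1] &, {homo rho : s t / s < t}} /\
  {in `[0, 1], forall s, rho s + rho (1 - s) = rhobar}.

Definition utility_on (R : realType) (a b : R) (U : R -> R) : Prop :=
  [/\ {within `[a, b], continuous U},
      {in `[a, b] &, {homo U : u v / u < v}} &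
      {in `[a, b] &, forall u v, u != v -> forall t : R, 0 < t < 1 ->
         t * U u + (1 - t) * U v < U (t * u + (1 - t) * v)}].

(* V_p(xA, xB); the integrand takes finitely many values, so [fine] loses
   nothing. *)
Definition payoff (R : realType) (nu : R -> R) (phi : R)
    (phi_lt : - phi < phi) (D : voter_dist R) (p : party) (xA xB : R) : R :=
  fine 'E_(uniform_prob phi_lt)[fun eps => nu (vote_share D p xA xB eps)].

Definition nash (R : realType) (nu : R -> R) (phi : R)
    (phi_lt : - phi < phi) (D : voter_dist R) (xA xB : R) : Prop :=
  [/\ platforms D xA, platforms D xB,
      forall y, platforms D y ->
        payoff nu phi_lt D PartyA y xB <= payoff nu phi_lt D PartyA xA xB &
      forall y, platforms D y ->
        payoff nu phi_lt D PartyB xA y <= payoff nu phi_lt D PartyB xA xB].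

Definition low_platform (R : realType) (nu : R -> R) (D : voter_dist R) : R :=
  \sum_(i < (extra_types D).+2)
    (nu (\sum_(j < (extra_types D).+2 | (j <= i)%N) share D j)
     - nu (\sum_(j < (extra_types D).+2 | (j < i)%N) share D j)) * bliss D i.

Definition high_platform (R : realType) (nu : R -> R) (D : voter_dist R) : R :=
  \sum_(i < (extra_types D).+2)
    (nu (\sum_(j < (extra_types D).+2 | (i <= j)%N) share D j)
     - nu (\sum_(j < (extra_types D).+2 | (i < j)%N) share D j)) * bliss D i.

Definition equilibrium_platforms (R : realType) (nu : R -> R) (phi : R)
    (phi_lt : - phi < phi) (D : voter_dist R) (lo hi : R) : Prop :=
  lo < hi /\
  forall xA xB, nash nu phi_lt D xA xB <->
    (xA, xB) = (hi, lo) \/ (xA, xB) = (lo, hi).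

Definition median_set (R : realType) (D : voter_dist R) : set R :=
  [set t | 2^-1 <= \sum_(i | bliss D i <= t) share D i /\
           2^-1 <= \sum_(i | t <= bliss D i) share D i].

(* [median_set] is a compact interval; this is its midpoint. *)
Definition median (R : realType) (D : voter_dist R) : R :=
  (inf (median_set D) + sup (median_set D)) / 2.

(* Shares of the half-electorates, of total mass 1/2 before the factor 2: a
   type located at the median gives each half what that half still lacks. *)
Definition left_share (R : realType) (D : voter_dist R)
    (i : 'I_(extra_types D).+2) : R :=
  2 * (if bliss D i < median D then share D i
       else if bliss D i == median D
            then 2^-1 - \sum_(j | bliss D j < median D) share D j
            else 0).

Definition right_share (R : realType) (D : voter_dist R)
    (i : 'I_(extra_types D).+2) : R :=
  2 * (if median D < bliss D i then share D i
       else if bliss D i == median D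
            then 2^-1 - \sum_(j | median D < bliss D j) share D j
            else 0).

Arguments left_share {R} D i.
Arguments right_share {R} D i.

Definition left_cdf (R : realType) (D : voter_dist R) (t : R) : R :=
  \sum_(i | bliss D i <= t) left_share D i.

Definition right_cdf (R : realType) (D : voter_dist R) (t : R) : R :=
  \sum_(i | bliss D i <= t) right_share D i.

(* Weak first-order stochastic dominance of F over G, stated on cdfs. *)
Definition fosd (R : realType) (F G : R -> R) : Prop := forall t, F t <= G t.

(* [is_spread D' D]: D' is a spread of D. *)
Definition is_spread (R : realType) (D' D : voter_dist R) : Prop :=
  [/\ fosd (left_cdf D) (left_cdf D'),
      fosd (right_cdf D') (right_cdf D) &
      left_cdf D <> left_cdf D' \/ right_cdf D' <> right_cdf D].

(* Main.v *)
(* For xA <= xB the supporters of A at shock eps form an initial segment of the types, so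
   nu(S_A) telescopes into a nu-weighted sum of indicators of [eps <= Delta_i].  As the shock is
   uniform with wide support, V_A is then, up to a constant,
   ((xB - L)^2 - (xA - L)^2) / (2 phi), with L the low platform; when xB <= xA, L is the high
   platform.  Best replies are explicit, and both parties get a constant plus
   (high - low)^2 / (2 phi) in equilibrium.  Summation by parts turns high - low into the integral
   of g(F(t)) - g(0), where F is the cdf of bliss points and g(s) = nu(s) + nu(1 - s).  By
   concavity of U and symmetry of rho, g is symmetric about 1/2 and increasing on [0, 1/2], while
   a spread moves F(t) towards 1/2 at every t once medians are aligned. *)

Require Import Defs.
From mathcomp Require Import all_boot all_order all_algebra.
From mathcomp Require Import all_classical all_reals all_analysis.
From mathcomp Require Import ring lra.
Set Implicit Arguments.
Unset Strict Implicit.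
Unset Printing Implicit Defensive.
Import Order.TTheory GRing.Theory Num.Theory.
Local Open Scope ring_scope.

(** * Step functions of a uniform shock and their means *)

(** Entries of [l] are pairs of a jump and its threshold, with no order or sign imposed, so
    indicators can be added freely. The function is left-continuous and equals [c] beyond all
    thresholds. *)
Definition step (R : realType) (c : R) (l : seq (R * R)) (t : R) : R :=
  c + \sum_(q <- l) q.1 * (t <= q.2)%R%:R.

(** The mean of [step c l] under the uniform law on [-phi, phi] when all thresholds lie there: the
    ray up to [q.2] has probability [(q.2 + phi) / (2 * phi)]. *)
Definition step_mean (R : realType) (phi c : R) (l : seq (R * R)) : R :=
  c + \sum_(q <- l) q.1 * ((q.2 + phi) / (2 * phi)).

Section Uniform.
Variables (R : realType) (phi : R) (phi_lt : - phi < phi).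
Let P : probability (measurableTypeR R) R := uniform_prob phi_lt.

Lemma uniform_prob_ray (a : R) : - phi <= a <= phi ->
  P [set t : R | t <= a]%classic = ((a + phi) / (2 * phi))%:E.
Proof.
move=> /andP[la ua]; rewrite /P /= /uniform_prob integral_uniform_pdf.
have -> : ([set t | t <= a] `&` `[- phi, phi] = `[- phi, a])%classic.
  apply/seteqP; split => x /=; rewrite !in_itv /=.
    by move=> [-> /andP[->]].
  by move=> /andP[-> xa]; split => //; exact: le_trans xa ua.
rewrite (eq_integral (fun=> (phi - - phi)^-1%:E)); last first.
  move=> x; rewrite inE /= in_itv /= /uniform_pdf => /andP[-> xa].
  by rewrite (le_trans xa ua).
rewrite integral_cst //= lebesgue_measure_itv /= lte_fin opprK.
case: ltgtP la => // [lta _|<- _]; last by rewrite mule0 addNr mul0r.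
by rewrite -EFinD -EFinM mulrC (_ : phi + phi = 2 * phi) //; ring.
Qed.

Lemma step_cons (c : R) q l :
  step c (q :: l) = ((fun t => q.1 * \1_([set t : R | t <= q.2]%classic) t)
    \+ step c l)%R.
Proof.
apply/funext => t; rewrite /step big_cons /= indicE addrCA; congr (_ * _ + _).
by congr (nat_of_bool _)%:R; apply/idP/idP; rewrite inE.
Qed.

Lemma measurable_ray (a : R) :
  measurable ([set t : R | t <= a]%classic : set (measurableTypeR R)).
Proof. by rewrite -set_itvNyc; exact: measurable_itv. Qed.

Lemma step_integrable (c : R) l :
  P.-integrable setT (EFin \o (step c l : measurableTypeR R -> R)).
Proof.
elim: l => [|q l IH].
  have -> : step c [::] = cst c by apply/funext => t; rewrite /step big_nil addr0.
  exact: finite_measure_integrable_cst.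
rewrite step_cons.
have -> : (EFin \o ((fun t : measurableTypeR R =>
    q.1 * \1_([set t : R | t <= q.2]%classic) t) \+ step c l)%R =
  ((fun t => q.1%:E * (\1_([set t : R | t <= q.2]%classic) t)%:E) \+ (EFin \o step c l)))%E.
  by apply/funext => t.
apply: integrableD => //.
apply: integrableZl => //.
apply: integrable_indic => //; exact: measurable_ray.
Qed.

Lemma step_expectation (c : R) l :
  all (fun q : R * R => - phi <= q.2 <= phi) l ->
  'E_P[step c l]%E = (step_mean phi c l)%:E.
Proof.
elim: l => [_|q l IH] /=.
  have -> : step c [::] = cst c by apply/funext => t; rewrite /step big_nil addr0.
  by rewrite expectation_cst /step_mean big_nil addr0.
move=> /andP[hq /IH]; rewrite step_cons unlock => {}IH.
under eq_integral do rewrite EFinD EFinM.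
have mr := measurable_ray q.2.
have ii : P.-integrable setT
  (fun t : measurableTypeR R => (\1_([set t : R | t <= q.2]%classic) t)%:E).
  by apply: integrable_indic.
rewrite integralD //=; last 2 first.
- by apply: integrableZl.
- exact: step_integrable.
rewrite integralZl // integral_indic // setIT IH.
have /= -> := uniform_prob_ray hq.
by rewrite -EFinM -EFinD /step_mean big_cons addrCA.
Qed.

End Uniform.

(** * Telescoping weights on initial segments of types *)

Lemma telescope_prefix (R : realType) (n : nat) (s : 'I_n -> R) (f : R -> R)
    (k : nat) : (k <= n)%N ->
  f (\sum_(i < n | (i < k)%N) s i) = f 0 + \sum_(i < n | (i < k)%N)
    (f (\sum_(j < n | (j <= i)%N) s j) - f (\sum_(j < n | (j < i)%N) s j)).
Proof.
elim: k => [_|k IH kn]; first by rewrite !big_pred0 ?addr0.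
pose i0 := Ordinal kn.
have last_eq (i : 'I_n) : ((i < k.+1)%N && (i != i0)) = (i < k)%N.
  rewrite ltnS [RHS]ltn_neqAle andbC; congr (_ && _).
rewrite [X in _ + X](bigD1 i0) /= ?leqnn // (eq_bigl _ _ last_eq).
by rewrite addrCA -(IH (ltnW kn)) subrK.
Qed.

Lemma down_closed_prefix (n : nat) (P : pred 'I_n) :
  (forall i j : 'I_n, (i <= j)%N -> P j -> P i) ->
  exists2 k, (k <= n)%N & forall i : 'I_n, P i = (i < k)%N.
Proof.
(* Taking successors makes [k] a length: the empty maximum 0 stands for the empty predicate. *)
move=> down; exists (\max_(i | P i) i.+1)%N.
  by apply/bigmax_leqP => i _; exact: ltn_ord.
move=> i; apply/idP/idP => [Pi|].
  exact: (bigop.leq_bigmax_cond (F := fun i : 'I_n => i.+1)).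
apply: contraLR => nPi; rewrite -leqNgt; apply/bigmax_leqP => j Pj.
by rewrite ltnNge; apply: contra nPi => /down; apply.
Qed.

Section Weights.
Variables (R : realType) (D : voter_dist R).
Implicit Type f : R -> R.

(** For [f := nu] these are the coefficients of the bliss points in [low_platform]; [f] stays free
    because [dual nu] and [two_party_utility nu] are weighed in the same way. *)
Definition weight f (i : 'I_(extra_types D).+2) : R :=
  f (\sum_(j < (extra_types D).+2 | (j <= i)%N) share D j)
  - f (\sum_(j < (extra_types D).+2 | (j < i)%N) share D j).

(** A down-closed set of types is an initial segment, over which the weights telescope. *)
Lemma weight_down_closed f (P : pred 'I_(extra_types D).+2) :
  (forall i j : 'I_(extra_types D).+2, (i <= j)%N -> P j -> P i) ->
  f (\sum_(i | P i) share D i) = f 0 + \sum_i weight f i * (P i)%:R.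
Proof.
move=> /down_closed_prefix[k kn Pk]; rewrite (eq_bigl _ _ Pk) telescope_prefix //.
congr (_ + _); rewrite big_mkcond; apply: eq_bigr => i _; rewrite Pk.
by case: ifP; rewrite ?mulr1 ?mulr0.
Qed.

Lemma sum_weight f : \sum_i weight f i = f 1 - f 0.
Proof.
have := @weight_down_closed f predT (fun _ _ _ _ => isT).
rewrite (share_sum1 D) => ->; rewrite addrC addKr.
by apply: eq_bigr => i _; rewrite mulr1.
Qed.

(** Passing to complementary shares turns final segments into initial ones, so that the high
    platform for [f] becomes the low platform for [dual f]. *)
Definition dual f (s : R) : R := - f (1 - s).

Lemma dual0 f : dual f 0 = - f 1. Proof. by rewrite /dual subr0. Qed.
Lemma dual1 f : dual f 1 = - f 0. Proof. by rewrite /dual subrr. Qed.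

Lemma share_compl (P : pred 'I_(extra_types D).+2) :
  \sum_(i | ~~ P i) share D i = 1 - \sum_(i | P i) share D i.
Proof. by rewrite -(share_sum1 D) [X in _ = X - _](bigID P) /= addrAC subrr add0r. Qed.

Lemma high_platform_dual f : high_platform f D = low_platform (dual f) D.
Proof.
apply: eq_bigr => i _; congr (_ * _); rewrite /dual opprK addrC.
rewrite -!share_compl; congr (- f _ + f _); apply: eq_bigl => j.
  by rewrite ltnNge.
by rewrite leqNgt.
Qed.

Lemma bliss_le (i j : 'I_(extra_types D).+2) : (i <= j)%N -> bliss D i <= bliss D j.
Proof.
rewrite leq_eqVlt => /orP[/eqP/val_inj ->//|ij].
by rewrite ltW // bliss_incr.
Qed.

Lemma share_mass_le (P Q : pred 'I_(extra_types D).+2) :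
  (forall i, P i -> Q i) -> \sum_(i | P i) share D i <= \sum_(i | Q i) share D i.
Proof.
move=> PQ; rewrite [leRHS](bigID P) /= (eq_bigl P); last first.
  by move=> i; case Pi: (P i); rewrite ?andbF // (PQ i Pi).
by rewrite lerDl sumr_ge0 // => i _; rewrite ltW // share_gt0.
Qed.

Lemma share_mass_itv (P : pred 'I_(extra_types D).+2) :
  0 <= \sum_(i | P i) share D i <= 1.
Proof.
rewrite -(share_sum1 D) share_mass_le // sumr_ge0 // => i _.
by rewrite ltW // share_gt0.
Qed.

Lemma weight_gt0 f i : {in `[0, 1] &, {homo f : s t / s < t}} -> 0 < weight f i.
Proof.
move=> fincr; rewrite subr_gt0; apply: fincr; rewrite ?in_itv /= ?share_mass_itv //.
rewrite [X in _ < X](bigD1 i) //= [X in _ < _ + X](eq_bigl (fun j : 'I__ => (j < i)%N)).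
  by rewrite ltrDr share_gt0.
by move=> j; rewrite [RHS]ltn_neqAle andbC.
Qed.

Lemma dual_incr f : {in `[0, 1] &, {homo f : s t / s < t}} ->
  {in `[0, 1] &, {homo dual f : s t / s < t}}.
Proof.
move=> fincr s t; rewrite !in_itv /= => s01 t01 st.
by rewrite ltrN2; apply: fincr; rewrite ?in_itv /=; lra.
Qed.

(** Positive weights of total 1 make the platform a convex combination of bliss points. *)
Lemma low_platform_in f : {in `[0, 1] &, {homo f : s t / s < t}} ->
  f 1 - f 0 = 1 -> platforms D (low_platform f D).
Proof.
move=> fincr f1; rewrite /platforms /= in_itv /=.
have w0 i : 0 <= weight f i by rewrite ltW // weight_gt0.
have sw (c : R) : c = \sum_i weight f i * c.
  by rewrite -mulr_suml sum_weight f1 mul1r.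
apply/andP; split; [rewrite [leLHS]sw|rewrite [leRHS]sw]; apply: ler_sum => i _;
  by apply: (ler_wpM2l (w0 i)); apply: bliss_le; rewrite ?leq0n //= -ltnS.
Qed.

End Weights.
Arguments weight {R} D f i.

(** * Closed form of the payoffs *)

(** The payoff at [y] against a rival at [z], up to an additive constant and the factor [2 * phi].
    The left party is measured from [lo], the right one from [hi]; at a tie both branches vanish. *)
Definition contest (R : realType) (lo hi y z : R) : R :=
  if y <= z then (z - lo) ^+ 2 - (y - lo) ^+ 2 else (z - hi) ^+ 2 - (y - hi) ^+ 2.

Section Payoff.
Variables (R : realType) (phi : R) (phi_lt : - phi < phi) (D : voter_dist R).

Let phi_gt0 : 0 < phi. Proof. by have := phi_lt; lra. Qed.

(** [Delta] is affine in the bliss point and the weights sum to 1, so its weighted mean is its value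
    at the weighted mean bliss point, [low_platform f D]. *)
Lemma sum_weight_Delta f (a b : R) : f 1 - f 0 = 1 ->
  \sum_i weight D f i * ((Delta D i a b + phi) / (2 * phi))
    = 2^-1 + ((b - low_platform f D) ^+ 2 - (a - low_platform f D) ^+ 2) / (2 * phi).
Proof.
move=> f1; have phi0 : phi != 0 by rewrite gt_eqF.
have E i : weight D f i * ((Delta D i a b + phi) / (2 * phi)) =
   (b ^+ 2 - a ^+ 2 + phi) / (2 * phi) * weight D f i
   + (a - b) / phi * (weight D f i * bliss D i).
  by rewrite /Delta; field.
under eq_bigr do rewrite E.
rewrite big_split /= -!mulr_sumr sum_weight f1 -/(low_platform f D).
by field.
Qed.

Lemma expectation_steps (c : R) (n : nat) (w d : 'I_n -> R) :
  (forall i, - phi <= d i <= phi) ->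
  fine 'E_(uniform_prob phi_lt)[fun eps => c + \sum_i w i * (eps <= d i)%R%:R]
    = c + \sum_i w i * ((d i + phi) / (2 * phi)).
Proof.
move=> hd; pose l := [seq (w i, d i) | i <- index_enum 'I_n].
have -> : (fun eps => c + \sum_i w i * (eps <= d i)%R%:R) = step c l.
  by apply/funext => t; rewrite /step big_map.
rewrite step_expectation; last by rewrite all_map; apply/allP => i _ /=.
by rewrite /= /step_mean big_map.
Qed.

Hypothesis wide : wide_support D phi.

Lemma Delta_itv (a b : R) i : platforms D a -> platforms D b ->
  - phi <= Delta D i a b <= phi.
Proof. by move=> pa pb; rewrite -ler_norml ltW // wide. Qed.

Lemma Delta_antitone (a b : R) (i j : 'I_(extra_types D).+2) :
  a <= b -> (i <= j)%N -> Delta D j a b <= Delta D i a b.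
Proof.
move=> ab /bliss_le xij; rewrite -subr_ge0.
have -> : Delta D i a b - Delta D j a b = 2 * ((b - a) * (bliss D j - bliss D i)).
  by rewrite /Delta; ring.
by rewrite !mulr_ge0 ?subr_ge0.
Qed.

Lemma Delta_monotone (a b : R) (i j : 'I_(extra_types D).+2) :
  b <= a -> (i <= j)%N -> Delta D i a b <= Delta D j a b.
Proof.
move=> ba /(Delta_antitone ba); rewrite /Delta; lra.
Qed.

Lemma weight_supporters f (a b eps : R) : a <= b ->
  f (\sum_(i | eps <= Delta D i a b) share D i)
    = f 0 + \sum_i weight D f i * (eps <= Delta D i a b)%R%:R.
Proof.
move=> ab; rewrite -weight_down_closed // => i j ij /le_trans; apply.
exact: Delta_antitone.
Qed.

(** Here the opponents of A form the initial segment. Since [f 1 - f 0] is the total weight,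
    complementing the indicators turns [f 0] plus a sum into [f 1] minus a sum. *)
Lemma weight_opponents f (a b eps : R) : b <= a ->
  f (1 - \sum_(i | eps <= Delta D i a b) share D i)
    = f 1 - \sum_i weight D f i * (eps <= Delta D i a b)%R%:R.
Proof.
move=> ba; rewrite -share_compl weight_down_closed; last first.
  by move=> i j ij; rewrite -!ltNge; apply: le_lt_trans; exact: Delta_monotone.
rewrite -[f 1](subrK (f 0)) -(sum_weight D f) [X in X - _]addrC -addrA -sumrB.
congr (_ + _); apply: eq_bigr => i _.
by case: (eps <= _); rewrite /= ?mulr1 ?mulr0 ?subr0 ?subrr.
Qed.

(** There are four cases, by party and by side. The weights of [nu] serve the party on the left,
    those of [dual nu] the party on the right, whose supporters form a final segment. *)
Lemma payoffE nu p (a b : R) : nu 1 - nu 0 = 1 -> platforms D a -> platforms D b ->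
  payoff nu phi_lt D p a b = nu 0 + 2^-1 +
    match p with
    | PartyA => contest (low_platform nu D) (high_platform nu D) a b
    | PartyB => contest (low_platform nu D) (high_platform nu D) b a
    end / (2 * phi).
Proof.
move=> nu1 pa pb; have dual_nu1 : dual nu 1 - dual nu 0 = 1.
  by rewrite dual0 dual1 opprK addrC.
have expect (c : R) w : fine 'E_(uniform_prob phi_lt)[fun eps => c +
    \sum_i w i * (eps <= Delta D i a b)%R%:R]
    = c + \sum_i w i * ((Delta D i a b + phi) / (2 * phi)).
  by apply: expectation_steps => i; exact: Delta_itv.
have wN f eps : \sum_i - weight D f i * (eps <= Delta D i a b)%R%:R
    = - \sum_i weight D f i * (eps <= Delta D i a b)%R%:R.
  by rewrite -sumrN; apply: eq_bigr => i _; rewrite mulNr.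
have wN' f : \sum_i - weight D f i * ((Delta D i a b + phi) / (2 * phi))
    = - \sum_i weight D f i * ((Delta D i a b + phi) / (2 * phi)).
  by rewrite -sumrN; apply: eq_bigr => i _; rewrite mulNr.
rewrite high_platform_dual /payoff /vote_share /contest.
case: p.
  case: leP => [ab|/ltW ba].
    transitivity (fine 'E_(uniform_prob phi_lt)[fun eps => nu 0 +
        \sum_i weight D nu i * (eps <= Delta D i a b)%R%:R]).
      by congr (fine (expectation _ _)); apply/funext => eps; exact: weight_supporters.
    by rewrite expect sum_weight_Delta // addrA.
  transitivity (fine 'E_(uniform_prob phi_lt)[fun eps => nu 0 +
      \sum_i weight D (dual nu) i * (eps <= Delta D i a b)%R%:R]).
    congr (fine (expectation _ _)); apply/funext => eps.
    have := weight_opponents (dual nu) eps ba.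
    by rewrite /dual subKr subrr => /eqP; rewrite eqr_oppLR opprB opprK addrC => /eqP.
  by rewrite expect sum_weight_Delta // addrA.
(* The payoff of B arises as [nu 1] minus a mean; [nu 1 = nu 0 + 1] brings it to the form found for
   A. *)
have E (u v x : R) : u = nu 1 - (2^-1 + (x ^+ 2 - v ^+ 2) / (2 * phi)) ->
    u = nu 0 + 2^-1 + (v ^+ 2 - x ^+ 2) / (2 * phi).
  by move=> ->; rewrite -[nu 1](subrK (nu 0)) nu1; field; rewrite gt_eqF.
case: leP => [ba|/ltW ab].
  transitivity (fine 'E_(uniform_prob phi_lt)[fun eps => nu 1 +
      \sum_i - weight D nu i * (eps <= Delta D i a b)%R%:R]).
    congr (fine (expectation _ _)); apply/funext => eps.
    by rewrite wN; exact: weight_opponents.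
  by rewrite expect wN' sum_weight_Delta //; exact: E.
transitivity (fine 'E_(uniform_prob phi_lt)[fun eps => nu 1 +
    \sum_i - weight D (dual nu) i * (eps <= Delta D i a b)%R%:R]).
  congr (fine (expectation _ _)); apply/funext => eps.
  have := weight_supporters (dual nu) eps ab.
  by rewrite wN /dual subr0 => /eqP; rewrite eqr_oppLR opprD opprK => /eqP.
by rewrite expect wN' sum_weight_Delta //; exact: E.
Qed.

End Payoff.

(** * Nash equilibria and their payoffs *)

Section Equilibrium.
Variables (R : realType) (nu : R -> R) (phi : R) (phi_lt : - phi < phi).
Variable D : voter_dist R.
Hypothesis nu_incr : {in `[0, 1] &, {homo nu : s t / s < t}}.
Hypothesis nu_norm : nu 1 - nu 0 = 1.
Hypothesis wide : wide_support D phi.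
Local Notation lo := (low_platform nu D).
Local Notation hi := (high_platform nu D).
Hypothesis lo_lt_hi : lo < hi.

Let phi2_gt0 : 0 < (2 * phi)^-1.
Proof. by rewrite invr_gt0; have := phi_lt; lra. Qed.

Lemma low_platform_platforms : platforms D lo.
Proof. exact: low_platform_in. Qed.

Lemma high_platform_platforms : platforms D hi.
Proof.
rewrite high_platform_dual; apply: low_platform_in; first exact: dual_incr.
by rewrite dual0 dual1 opprK addrC.
Qed.

(** Payoffs are one increasing affine function of [contest], so replies can be compared on [contest]
    alone. *)
Lemma nash_contest a b : nash nu phi_lt D a b <->
  [/\ platforms D a, platforms D b,
      forall y, platforms D y -> contest lo hi y b <= contest lo hi a b &
      forall y, platforms D y -> contest lo hi y a <= contest lo hi b a].
Proof.
by split=> -[pa pb ha hb]; split=> // y py;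
  [have := ha y py|have := hb y py|have := ha y py|have := hb y py];
  rewrite !payoffE //= lerD2l (ler_pM2r phi2_gt0).
Qed.

Lemma contest_lo_hi : contest lo hi lo hi = (hi - lo) ^+ 2.
Proof. by rewrite /contest ltW // subrr expr0n subr0. Qed.

Lemma contest_hi_lo : contest lo hi hi lo = (hi - lo) ^+ 2.
Proof. by rewrite /contest leNgt lo_lt_hi /= subrr expr0n subr0 -sqrrN opprB. Qed.

(** Against either of [lo] and [hi] no reply gets more than [(hi - lo) ^+ 2], which the other one
    attains. Conversely, in an equilibrium with [y <= z], two deviations, of the left party to [lo]
    and of the right party to [hi], already pin both platforms down; the other order exchanges the
    parties. *)
Lemma nashE a b : nash nu phi_lt D a b <-> (a, b) = (hi, lo) \/ (a, b) = (lo, hi).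
Proof.
have lo_in := low_platform_platforms; have hi_in := high_platform_platforms.
have best_lo y : contest lo hi y hi <= (hi - lo) ^+ 2.
  rewrite /contest; have := sqr_ge0 (y - lo); have := sqr_ge0 (y - hi).
  have := sqr_ge0 (hi - lo).
  by case: (leP y hi) => _ h1 h2 h3; lra.
have best_hi y : contest lo hi y lo <= (hi - lo) ^+ 2.
  rewrite /contest; have := sqr_ge0 (y - lo); have := sqr_ge0 (y - hi).
  have := sqr_ge0 (hi - lo).
  by case: (leP y lo) => _ h1 h2 h3; lra.
have ordered (y z : R) :
    (forall x, platforms D x -> contest lo hi x z <= contest lo hi y z) ->
    (forall x, platforms D x -> contest lo hi x y <= contest lo hi z y) ->
    y <= z -> y = lo /\ z = hi.
  move=> hy hz yz; have := hy _ lo_in; have := hz _ hi_in.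
  have -> : contest lo hi z y = (y - hi) ^+ 2 - (z - hi) ^+ 2.
    rewrite /contest; case: (leP z y) => // zy.
    by have -> : z = y by [apply/le_anti; rewrite zy]; rewrite !subrr.
  have sq0 (u v : R) : (u - v) ^+ 2 <= 0 -> u = v.
    by move=> uv; apply/eqP; rewrite -subr_eq0 -sqrf_eq0 eq_le uv sqr_ge0.
  have lh := lo_lt_hi.
  have -> : contest lo hi y z = (z - lo) ^+ 2 - (y - lo) ^+ 2 by rewrite /contest yz.
  have -> : contest lo hi hi y = if hi <= y then (y - lo) ^+ 2 - (hi - lo) ^+ 2
      else (y - hi) ^+ 2 by rewrite /contest subrr expr0n subr0.
  rewrite /contest subrr expr0n subr0.
  (* If [lo <= z], the deviation to [lo] forces [y = lo]; if [y < hi], the deviation to [hi] forces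
     [z = hi]. The other combinations contradict [lo < hi]. *)
  case: (leP lo z) => [lz|zl]; case: (leP hi y) => [hy'|yh] h1 h2.
  - by have := sq0 y lo; lra.
  - by have yl : y = lo; [apply: sq0; lra|split=> //; apply: sq0; lra].
  - by lra.
  - by exfalso; have := sq0 z hi; lra.
rewrite nash_contest; split=> [[pa pb ha hb]|[|] [-> ->]].
- have [/(ordered a b ha hb)|/ltW /(ordered b a hb ha)] := leP a b => -[-> ->].
    by right.
  by left.
- by split=> // y _; rewrite ?contest_lo_hi ?contest_hi_lo.
- by split=> // y _; rewrite ?contest_lo_hi ?contest_hi_lo.
Qed.

Lemma nash_payoff p a b : nash nu phi_lt D a b ->
  payoff nu phi_lt D p a b = nu 0 + 2^-1 + (hi - lo) ^+ 2 / (2 * phi).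
Proof.
have lo_in := low_platform_platforms; have hi_in := high_platform_platforms.
by move=> /nashE[] [-> ->]; rewrite payoffE //; case: p;
  rewrite ?contest_lo_hi ?contest_hi_lo.
Qed.

End Equilibrium.

(** * Strict comparison of means of step functions *)

(** This is left-continuity in a uniform form; the prescribed lower bound [b] allows nesting the
    intervals of two step functions. *)
Lemma step_left_cst (R : realType) (c b t0 : R) l : b < t0 ->
  exists u, [/\ b <= u, u < t0 & forall t, u < t <= t0 -> step c l t = step c l t0].
Proof.
move=> bt0; elim: l => [|q l [u [bu ut IH]]].
  by exists b; split => // t _; rewrite /step !big_nil.
have stepS t : step c (q :: l) t = q.1 * (t <= q.2)%R%:R + step c l t.
  by rewrite /step big_cons addrCA.
case: (leP t0 q.2) => tq.
  exists u; split=> // t ut0; rewrite !stepS IH // tq.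
  by case/andP: ut0 => _ /le_trans ->.
exists (Num.max u q.2); split; first by rewrite le_max bu.
  by rewrite gt_max ut.
move=> t /andP[]; rewrite gt_max => /andP[ut' qt] tt0.
by rewrite !stepS IH ?ut' // leNgt qt leNgt tq.
Qed.

Section StepMean.
Variables (R : realType) (phi : R).
Local Notation inside := (all (fun q : R * R => - phi <= q.2 <= phi)).

Lemma step_mean_le (c1 c2 : R) l1 l2 : 0 < phi -> inside l1 -> inside l2 ->
  (forall t, step c1 l1 t <= step c2 l2 t) ->
  step_mean phi c1 l1 <= step_mean phi c2 l2.
Proof.
move=> phi0 in1 in2 le12; have phi_lt : - phi < phi by lra.
rewrite -lee_fin -(step_expectation phi_lt) // -(step_expectation phi_lt) // unlock.
by apply: le_integral => //; [exact: step_integrable..|move=> t _; rewrite lee_fin].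
Qed.

(** A strict gap [d] at [t0] persists on some interval [(u, t0]] inside the support. Adding a bump
    of height [d] there keeps the first function below the second, and the bump has positive
    mean. *)
Lemma step_mean_lt (c1 c2 t0 : R) l1 l2 : - phi < t0 <= phi ->
  inside l1 -> inside l2 ->
  (forall t, step c1 l1 t <= step c2 l2 t) -> step c1 l1 t0 < step c2 l2 t0 ->
  step_mean phi c1 l1 < step_mean phi c2 l2.
Proof.
move=> /andP[lt0 t0u] in1 in2 le12 lt12; have phi0 : 0 < phi by lra.
have [u1 [pu1 u1t E1]] := step_left_cst c1 l1 lt0.
have [u [u1u ut E2]] := step_left_cst c2 l2 u1t.
pose d := step c2 l2 t0 - step c1 l1 t0; have d0 : 0 < d by rewrite subr_gt0.
have stepE t : step c1 [:: (d, t0), (- d, u) & l1] t =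
    d * (t <= t0)%R%:R - d * (t <= u)%R%:R + step c1 l1 t.
  by rewrite /step !big_cons /=; ring.
have : step_mean phi c1 [:: (d, t0), (- d, u) & l1] <= step_mean phi c2 l2.
  apply: step_mean_le => //=; first by rewrite in1; lra.
  move=> t; rewrite stepE; have := le12 t.
  case: (leP t t0) => tt0; case: (leP t u) => tu; rewrite ?mulr1 ?mulr0; try lra.
  by rewrite E1 ?(le_lt_trans u1u tu) // E2 ?tu // /d; lra.
apply: lt_le_trans.
have -> : step_mean phi c1 [:: (d, t0), (- d, u) & l1]
    = d * (t0 - u) / (2 * phi) + step_mean phi c1 l1.
  by rewrite /step_mean !big_cons /=; field; rewrite gt_eqF.
by rewrite ltrDr divr_gt0 ?mulr_gt0 ?subr_gt0.
Qed.

End StepMean.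

(** * The platform gap as a mean over the cdf of bliss points *)

(** It equals [f - dual f], so its weights are the differences of those defining the low and high
    platforms. *)
Definition two_party_utility (R : realType) (f : R -> R) (s : R) : R := f s + f (1 - s).

Lemma two_party_utility_sym (R : realType) (f : R -> R) (s : R) :
  two_party_utility f (1 - s) = two_party_utility f s.
Proof. by rewrite /two_party_utility subKr addrC. Qed.

Section Gap.
Variables (R : realType) (nu : R -> R).
Local Notation g := (two_party_utility nu).

Definition cdf_share (D : voter_dist R) (t : R) : R := \sum_(i | bliss D i <= t) share D i.

(* The abscissa is reversed to turn [bliss <= t] into the left-continuous [t <= - bliss]. *)
Definition cdf_steps (D : voter_dist R) : seq (R * R) :=
  [seq (weight D g i, - bliss D i) | i <- index_enum 'I_(extra_types D).+2].

Lemma cdf_stepsE D t : step (g 0) (cdf_steps D) t = g (cdf_share D (- t)).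
Proof.
rewrite /step /cdf_share weight_down_closed; last first.
  by move=> i j /bliss_le xij; exact: le_trans.
rewrite big_map; congr (_ + _); apply: eq_bigr => i _ /=.
by rewrite lerNr.
Qed.

(** The weights of [g] sum to [g 1 - g 0 = 0], which removes the offset 1/2; the reflected
    thresholds give the gap its sign. Here [phi] is any positive number. *)
Lemma cdf_steps_mean (D : voter_dist R) (phi : R) : 0 < phi ->
  step_mean phi (g 0) (cdf_steps D)
    = g 0 + (high_platform nu D - low_platform nu D) / (2 * phi).
Proof.
move=> phi0; rewrite /step_mean big_map; congr (_ + _).
have E i : weight D g i * ((- bliss D i + phi) / (2 * phi)) =
    2^-1 * weight D g i
    + (2 * phi)^-1 * (weight D (dual nu) i * bliss D i - weight D nu i * bliss D i).
  by rewrite /weight /two_party_utility /dual; field; rewrite gt_eqF.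
under eq_bigr do rewrite /= E.
rewrite big_split /= -!mulr_sumr sum_weight sumrB high_platform_dual.
by rewrite /two_party_utility subr0 subrr [nu 1 + _]addrC subrr mulr0 add0r mulrC.
Qed.

Lemma cdf_steps_inside (D : voter_dist R) (phi : R) :
  (forall i, `|bliss D i| <= phi) ->
  all (fun q : R * R => - phi <= q.2 <= phi) (cdf_steps D).
Proof.
by move=> hD; rewrite all_map; apply/allP => i _ /=; rewrite -ler_norml normrN.
Qed.

Lemma bliss_bound (D : voter_dist R) i : `|bliss D i| <= \sum_j `|bliss D j|.
Proof. by rewrite (bigD1 i) //= lerDl sumr_ge0. Qed.

(** Both gaps are read off, with the same constants, from means over one common window, so a
    pointwise comparison of [g] along the cdfs carries over. *)
Lemma platform_gap_lt (D D' : voter_dist R) (t0 : R) :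
  (forall t, g (cdf_share D t) <= g (cdf_share D' t)) ->
  g (cdf_share D t0) < g (cdf_share D' t0) ->
  high_platform nu D - low_platform nu D < high_platform nu D' - low_platform nu D'.
Proof.
move=> le_g lt_g.
(* An auxiliary window, unrelated to the shock: it contains all reflected bliss points, and the
   added 1 keeps [- t0] off its left end. *)
pose phi := \sum_j `|bliss D j| + \sum_j `|bliss D' j| + `|t0| + 1.
have S0 (E : voter_dist R) : 0 <= \sum_j `|bliss E j| by apply: sumr_ge0.
have [s0 s0'] := (S0 D, S0 D').
have t0_ge0 := normr_ge0 t0.
have /andP[nt0 t0n] : - `|t0| <= t0 <= `|t0| by rewrite -ler_norml.
have phi0 : 0 < phi by rewrite /phi; lra.
have : step_mean phi (g 0) (cdf_steps D) < step_mean phi (g 0) (cdf_steps D').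
  apply: (@step_mean_lt _ _ _ _ (- t0)).
  - by rewrite /phi; apply/andP; split; lra.
  - by apply: cdf_steps_inside => i; have := bliss_bound i; rewrite /phi; lra.
  - by apply: cdf_steps_inside => i; have := bliss_bound i; rewrite /phi; lra.
  - by move=> t; rewrite !cdf_stepsE.
  - by rewrite !cdf_stepsE opprK.
by rewrite !cdf_steps_mean // ltrD2l ltr_pM2r // invr_gt0 mulr_gt0.
Qed.

(** The constant [g 0] is compared with [g] along the cdf; at the leftmost bliss point the cdf is
    strictly between 0 and 1, as there are at least two types. *)
Lemma low_lt_high_platform (D : voter_dist R) :
  (forall s, 0 <= s <= 1 -> g 0 <= g s) -> (forall s, 0 < s < 1 -> g 0 < g s) ->
  low_platform nu D < high_platform nu D.
Proof.
move=> le_g lt_g; pose t0 := bliss D ord0.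
pose phi := \sum_j `|bliss D j| + 1.
have phi0 : 0 < phi by rewrite ltr_pwDr // sumr_ge0.
have : step_mean phi (g 0) [::] < step_mean phi (g 0) (cdf_steps D).
  have step0 t : step (g 0) [::] t = g 0 by rewrite /step big_nil addr0.
  apply: (@step_mean_lt _ _ _ _ (- t0)) => //.
  - have := bliss_bound (ord0 : 'I_(extra_types D).+2).
    rewrite ler_norml -/t0 /phi => /andP[? ?].
    by apply/andP; split; lra.
  - by apply: cdf_steps_inside => i; rewrite (le_trans (bliss_bound i)) // lerDl.
  - by move=> t; rewrite step0 cdf_stepsE le_g // share_mass_itv.
  rewrite step0 cdf_stepsE opprK; apply: lt_g; rewrite /cdf_share; apply/andP; split.
    rewrite (bigD1 ord0) //= ltr_pwDl ?share_gt0 // sumr_ge0 // => i _.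
    by rewrite ltW // share_gt0.
  rewrite -subr_gt0 -share_compl (bigD1 ord_max) /=; last first.
    by rewrite -ltNge bliss_incr.
  by rewrite ltr_pwDl ?share_gt0 // sumr_ge0 // => i _; rewrite ltW // share_gt0.
rewrite cdf_steps_mean // /step_mean big_nil ltrD2l pmulr_lgt0 ?subr_gt0 //.
by rewrite invr_gt0 mulr_gt0.
Qed.

End Gap.

(** * Monotonicity of the two-party utility from concavity *)

Section Utility.
Variables (R : realType) (rho U : R -> R) (rhobar : R).
Hypothesis Hrho : power_rule rho rhobar.
Hypothesis HU : utility_on (rho 0) (rho 1) U.
Local Notation nu := (U \o rho).
Local Notation g := (two_party_utility nu).

Lemma power_rule_in (s : R) : 0 <= s <= 1 -> rho s \in `[rho 0, rho 1].
Proof.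
case: Hrho => incr _ /andP[s0 s1]; rewrite in_itv /=; apply/andP; split.
  move: s0; rewrite [in X in X -> _]le_eqVlt => /orP[/eqP<- //|s0].
  by apply/ltW/incr; rewrite ?in_itv /= ?lexx ?ler01 ?s1 ?(ltW s0).
move: s1; rewrite [in X in X -> _]le_eqVlt => /orP[/eqP-> //|s1].
by apply/ltW/incr; rewrite ?in_itv /= ?lexx ?ler01 ?s0 ?(ltW s1).
Qed.

Lemma utility_power_incr : {in `[0, 1] &, {homo nu : s t / s < t}}.
Proof.
case: (HU) => _ Uincr _ s t s01 t01 st /=.
apply: Uincr; [exact: power_rule_in|exact: power_rule_in|].
by case: Hrho => incr _; exact: incr.
Qed.

(* With u = rho s and v = rho s', the powers v and rhobar - v are strict convex combinations,
   with exchanged weights, of u and rhobar - u. *)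
Lemma two_party_utility_lt s s' : 0 <= s -> s < s' -> s' <= 2^-1 -> g s < g s'.
Proof.
move=> s0 ss' s'h; case: (HU) => _ _ Uconc; case: (Hrho) => incr sym.
have in01 x : 0 <= x -> x <= 1 -> x \in `[0, 1] by rewrite in_itv /= => -> ->.
have symE x : 0 <= x -> x <= 1 -> rho (1 - x) = rhobar - rho x.
  by move=> x0 x1; rewrite -(sym x) ?in01 // addrAC subrr add0r.
have uv : rho s < rho s' by apply: incr; rewrite ?in01 //; lra.
have vv : rho s' <= rho (1 - s').
  have : s' <= 1 - s' by lra.
  rewrite [in X in X -> _]le_eqVlt => /orP[/eqP <- //|h]; apply/ltW/incr => //; apply: in01; lra.
have Iu : rho s \in `[rho 0, rho 1] by apply: power_rule_in; lra.
have Iw : rho (1 - s) \in `[rho 0, rho 1] by apply: power_rule_in; lra.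
have e1 : rho (1 - s) = rhobar - rho s by apply: symE; lra.
have e2 : rho (1 - s') = rhobar - rho s' by apply: symE; lra.
rewrite /two_party_utility /=; set u := rho s in uv Iu e1 *.
set v := rho s' in uv vv e2 *; set w := rho (1 - s) in Iw e1 *.
set z := rho (1 - s') in vv e2 *.
have uw : u < w by lra.
pose t := (w - v) / (w - u).
have t01 : 0 < t < 1.
  by rewrite /t divr_gt0 ?subr_gt0 /=; [rewrite ltr_pdivrMr ?subr_gt0 ?mul1r; lra|lra|lra].
have wu0 : w - u != 0 by rewrite subr_eq0 gt_eqF.
have t01' : 0 < 1 - t < 1 by case/andP: t01 => ? ?; apply/andP; split; lra.
have ev : t * u + (1 - t) * w = v by rewrite /t; field.
have ez : (1 - t) * u + (1 - (1 - t)) * w = z.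
  by have -> : z = u + w - v by [lra]; rewrite -ev; ring.
have uw' : u != w by rewrite lt_eqF.
have := Uconc _ _ Iu Iw uw' _ t01; rewrite ev.
have := Uconc _ _ Iu Iw uw' _ t01'; rewrite ez.
by lra.
Qed.

Lemma two_party_utility_le s s' : 0 <= s -> s <= s' -> s' <= 2^-1 -> g s <= g s'.
Proof.
move=> s0; rewrite [in X in X -> _]le_eqVlt => /orP[/eqP-> //|ss' s'h].
by rewrite ltW // two_party_utility_lt.
Qed.

Lemma two_party_utility0_lt (s : R) : 0 < s < 1 -> g 0 < g s.
Proof.
move=> /andP[s0 s1]; case: (leP s 2^-1) => sh; first exact: two_party_utility_lt.
by rewrite -(two_party_utility_sym _ s); apply: two_party_utility_lt; lra.
Qed.

Lemma two_party_utility0_le (s : R) : 0 <= s <= 1 -> g 0 <= g s.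
Proof.
move=> /andP[s0 s1]; case: (leP s 2^-1) => sh; first exact: two_party_utility_le.
by rewrite -(two_party_utility_sym _ s); apply: two_party_utility_le; lra.
Qed.

End Utility.

(** * Medians, half-electorates and translations *)

Section Shift.
Variables (R : realType) (E : set R) (c : R).
Hypothesis E0 : (E !=set0)%classic.
Local Notation Ec := ([set t | E (t + c)]%classic).

Let Ec0 : (Ec !=set0)%classic.
Proof. by case: E0 => x Ex; exists (x - c); rewrite /= subrK. Qed.

Lemma sup_shift : has_ubound E -> sup Ec = sup E - c.
Proof.
move=> ubE.
have le1 : ubound Ec (sup E - c) by move=> x Ex; rewrite lerBrDr; exact: ub_le_sup.
apply/le_anti/andP; split; first exact: ge_sup.
rewrite lerBlDr; apply: ge_sup => // x Ex; rewrite -lerBlDr.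
by apply: ub_le_sup; [exists (sup E - c)|rewrite /= subrK].
Qed.

Lemma inf_shift : has_lbound E -> inf Ec = inf E - c.
Proof.
move=> lbE.
have le1 : lbound Ec (inf E - c) by move=> x Ex; rewrite lerBlDr; exact: ge_inf.
apply/le_anti/andP; split; last exact: lb_le_inf.
rewrite lerBrDr; apply: lb_le_inf => // x Ex; rewrite -lerBrDr.
by apply: ge_inf; [exists (inf E - c)|rewrite /= subrK].
Qed.

End Shift.

Section Median.
Variables (R : realType) (D : voter_dist R).

Lemma median_set_bounds t : median_set D t -> bliss D ord0 <= t <= bliss D ord_max.
Proof.
move=> [h1 h2]; rewrite !leNgt; apply/andP; split; apply/negP => lt_t.
  move: h1; rewrite big_pred0 ?leNgt ?invr_gt0 ?ltr0n // => i.
  by apply/negbTE; rewrite -ltNge (lt_le_trans lt_t) // bliss_le.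
move: h2; rewrite big_pred0 ?leNgt ?invr_gt0 ?ltr0n // => i.
by apply/negbTE; rewrite -ltNge (le_lt_trans _ lt_t) // bliss_le // -ltnS.
Qed.

(** The first type whose cumulative share reaches 1/2 is a median: if more than half lay strictly
    below it, the closest type below would reach 1/2 too. *)
Lemma median_set_nonempty : (median_set D !=set0)%classic.
Proof.
pose P i := 2^-1 <= cdf_share D (bliss D i).
have Pmax : P ord_max.
  rewrite /P /cdf_share (eq_bigl predT) ?share_sum1; first lra.
  by move=> i; rewrite bliss_le // -ltnS.
case: (arg_minnP (fun i : 'I__ => val i) Pmax) => i Pi imin.
exists (bliss D i); split=> //; rewrite leNgt; apply/negP => lt_half.
have below : 2^-1 < \sum_(j | bliss D j < bliss D i) share D j.
  rewrite (eq_bigl (fun j => ~~ (bliss D i <= bliss D j))).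
    by rewrite share_compl; lra.
  by move=> j; rewrite ltNge.
case: (pickP (fun j => bliss D j < bliss D i)) => [j0 ltj0|none]; last first.
  by move: below; rewrite big_pred0 //; lra.
case: (@arg_maxnP _ j0 (fun j => bliss D j < bliss D i) (fun j => val j) ltj0) => k ltk kmax.
have : P k.
  rewrite /P; apply/ltW/(lt_le_trans below)/share_mass_le => j /kmax kj.
  exact: bliss_le.
by move=> /imin /bliss_le; rewrite leNgt ltk.
Qed.

Lemma median_set_convex a b t :
  median_set D a -> median_set D b -> a <= t <= b -> median_set D t.
Proof.
move=> [ha _] [_ hb] /andP[a_t tb]; split.
  by apply: (le_trans ha); apply: share_mass_le => i /le_trans; apply.
by apply: (le_trans hb); apply: share_mass_le => i; exact: le_trans.
Qed.

Lemma median_set_has_lbound : has_lbound (median_set D).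
Proof. by exists (bliss D ord0) => t /median_set_bounds /andP[]. Qed.

Lemma median_set_has_ubound : has_ubound (median_set D).
Proof. by exists (bliss D ord_max) => t /median_set_bounds /andP[]. Qed.

(** The median set is convex. If it is not a single point, members within half its width of the
    infimum and of the supremum enclose the midpoint. *)
Lemma median_in : median_set D (median D).
Proof.
have [lb ub] := (median_set_has_lbound, median_set_has_ubound).
have [x Mx] := median_set_nonempty.
have ix : inf (median_set D) <= x by exact: ge_inf.
have xs : x <= sup (median_set D) by exact: ub_le_sup.
have [eq_is|/eqP ne_is] := eqVneq (inf (median_set D)) (sup (median_set D)).
  by have -> : median D = x by rewrite /median; lra.
have lt_is : inf (median_set D) < sup (median_set D).
  by rewrite lt_neqAle (le_trans ix xs) andbT; exact/eqP.
pose e := (sup (median_set D) - inf (median_set D)) / 2.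
have e0 : 0 < e by rewrite divr_gt0 // subr_gt0.
have [a Ma la] := inf_adherent e0 (conj median_set_nonempty lb).
have [b Mb lb'] := sup_adherent e0 (conj median_set_nonempty ub).
apply: (median_set_convex Ma Mb); rewrite /median.
by move: la lb'; rewrite /e => la lb'; apply/andP; split; lra.
Qed.

Local Notation m := (median D).
Local Notation F := (cdf_share D).

Lemma cdf_share_lt_median t : t < m -> F t <= 2^-1.
Proof.
move=> tm; have [_ h] := median_in.
have : F t <= \sum_(i | ~~ (m <= bliss D i)) share D i.
  by apply: share_mass_le => i it; rewrite -ltNge (le_lt_trans it).
by rewrite share_compl; lra.
Qed.

Lemma cdf_share_ge_median t : m <= t -> 2^-1 <= F t.
Proof.
move=> mt; have [h _] := median_in; apply: (le_trans h).
by apply: share_mass_le => i im; exact: le_trans mt.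
Qed.

Lemma below_median :
  \sum_(i | bliss D i < m) share D i = 1 - \sum_(i | m <= bliss D i) share D i.
Proof. by rewrite -share_compl; apply: eq_bigl => i; rewrite ltNge. Qed.

Lemma above_median : \sum_(i | m < bliss D i) share D i = 1 - F m.
Proof. by rewrite -share_compl; apply: eq_bigl => i; rewrite ltNge. Qed.

(* Without an atom at the median, both halves already have mass 1/2. *)
Lemma sum_atom (c : R) : ((forall i, bliss D i != m) -> c = 0) ->
  \sum_(i | bliss D i == m) c = c.
Proof.
move=> c0; case: (pickP (fun i => bliss D i == m)) => [i0 /eqP xi0|none].
  rewrite (big_pred1 i0) // => i; apply/eqP/eqP => [|-> //].
  by rewrite -xi0 => eqx; apply/val_inj; case: (ltngtP i i0) => // /bliss_incr;
    rewrite eqx ltxx.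
by rewrite big_pred0 // c0 // => i; rewrite none.
Qed.

Lemma no_atom_half : (forall i, bliss D i != m) ->
  F m = 2^-1 /\ \sum_(i | bliss D i < m) share D i = 2^-1.
Proof.
move=> na; have [h1 h2] := median_in.
have -> : \sum_(i | bliss D i < m) share D i = F m.
  by apply: eq_bigl => i; rewrite lt_neqAle na.
suff : F m <= 2^-1 by move: h1; rewrite -/(F m) => ? ?; split; apply/le_anti/andP.
have -> : F m = \sum_(i | bliss D i < m) share D i.
  by apply: eq_bigl => i; rewrite lt_neqAle na.
by rewrite below_median; lra.
Qed.

Lemma left_cdf_lt_median t : t < m -> left_cdf D t = 2 * F t.
Proof.
move=> tm; rewrite /left_cdf mulr_sumr; apply: eq_bigr => i it.
by rewrite /left_share (le_lt_trans it tm).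
Qed.

(** The atom at the median tops the mass below it up to 1/2, and doubling gives 1. *)
Lemma left_cdf_ge_median t : m <= t -> left_cdf D t = 1.
Proof.
move=> mt; rewrite /left_cdf /left_share.
set c := 2^-1 - _; have Ec : \sum_(i | bliss D i == m) c = c.
  by apply: sum_atom => /no_atom_half[_ hl]; rewrite /c hl subrr.
transitivity (2 * (\sum_(i | bliss D i < m) share D i + \sum_(i | bliss D i == m) c)).
  rewrite big_mkcond [in RHS]big_mkcond [X in _ + X]big_mkcond -big_split mulr_sumr.
  apply: eq_bigr => i _ /=.
  case: (ltgtP (bliss D i) m) => [lt_im|lt_mi|->]; rewrite ?addr0 ?add0r ?mulr0 ?if_same //.
    by rewrite (le_trans (ltW lt_im) mt).
  by rewrite mt.
by rewrite Ec /c addrC subrK divff ?pnatr_eq0.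
Qed.

Lemma right_cdf_lt_median t : t < m -> right_cdf D t = 0.
Proof.
move=> tm; rewrite /right_cdf big1 // => i it; rewrite /right_share.
have im := le_lt_trans it tm.
by rewrite ltNge (ltW im) /= lt_eqF // mulr0.
Qed.

(** The right half receives [F m - 1/2] from the atom, so it holds [F t - 1/2] up to [t] before
    doubling. *)
Lemma right_cdf_ge_median t : m <= t -> right_cdf D t = 2 * F t - 1.
Proof.
move=> mt; rewrite /right_cdf /right_share above_median.
set c := 2^-1 - _; have Ec : \sum_(i | bliss D i == m) c = c.
  by apply: sum_atom => /no_atom_half[hl _]; rewrite /c hl; lra.
have Ft : F t = F m + \sum_(i | (m < bliss D i) && (bliss D i <= t)) share D i.
  rewrite /cdf_share (bigID (fun i => bliss D i <= m)) /=; congr (_ + _).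
    apply: eq_bigl => i; case: (leP (bliss D i) m) => im; last by rewrite andbF.
    by rewrite (le_trans im mt).
  by apply: eq_bigl => i; rewrite ltNge andbC.
transitivity (2 * (\sum_(i | (m < bliss D i) && (bliss D i <= t)) share D i
    + \sum_(i | bliss D i == m) c)).
  rewrite big_mkcond [in RHS]big_mkcond [X in _ + X]big_mkcond -big_split mulr_sumr.
  apply: eq_bigr => i _ /=.
  case: (ltgtP (bliss D i) m) => [lt_im|lt_mi|->]; rewrite ?addr0 ?add0r ?mulr0 ?if_same //.
    by case: ifP; rewrite ?mulr0.
  by rewrite mt.
by rewrite Ec /c Ft; lra.
Qed.

Lemma median_translate (c : R) : median (translate D c) = m - c.
Proof.
rewrite /median.
have -> : median_set (translate D c) = [set t | median_set D (t + c)]%classic.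
  apply/seteqP; split=> t; rewrite /median_set /= => -[h1 h2]; split.
  - by under eq_bigl do rewrite -lerBlDr.
  - by under eq_bigl do rewrite -lerBrDr.
  - by under eq_bigl do rewrite lerBlDr.
  - by under eq_bigl do rewrite lerBrDr.
rewrite (sup_shift c median_set_nonempty median_set_has_ubound).
rewrite (inf_shift c median_set_nonempty median_set_has_lbound).
by field.
Qed.

Lemma low_platform_translate nu (c : R) : nu 1 - nu 0 = 1 ->
  low_platform nu (translate D c) = low_platform nu D - c.
Proof.
move=> nu1; rewrite -[c in RHS]mul1r -nu1 -(sum_weight D nu) mulr_suml -sumrB.
by apply: eq_bigr => i _; rewrite -mulrBr.
Qed.

Lemma high_platform_translate nu (c : R) : nu 1 - nu 0 = 1 ->
  high_platform nu (translate D c) = high_platform nu D - c.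
Proof.
move=> nu1; rewrite !high_platform_dual low_platform_translate //.
by rewrite dual0 dual1 opprK addrC.
Qed.

End Median.

(** * Effect of a spread on the gap and on payoffs *)

Lemma is_spread_platform_gap_lt (R : realType) (rho U : R -> R) (rhobar : R)
    (D D' : voter_dist R) :
  power_rule rho rhobar -> utility_on (rho 0) (rho 1) U ->
  median D = median D' -> is_spread D' D ->
  high_platform (U \o rho) D - low_platform (U \o rho) D
    < high_platform (U \o rho) D' - low_platform (U \o rho) D'.
Proof.
move=> Hrho HU eqm [le_left le_right ne_cdf].
set g := two_party_utility (U \o rho).
have F01 (E : voter_dist R) t : 0 <= cdf_share E t <= 1 by exact: share_mass_itv.
(* The left cdf is [2 * F] below the median and the right cdf is [2 * F - 1] from it on, so each
   dominance relation orders the full cdfs on its own side. *)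
have half t : t < median D /\ cdf_share D t <= cdf_share D' t <= 2^-1 \/
    median D <= t /\ 2^-1 <= cdf_share D' t <= cdf_share D t.
  case: (ltP t (median D)) => tm; [left|right]; split=> //.
    have := le_left t; rewrite !left_cdf_lt_median -?eqm // => le_t.
    by rewrite cdf_share_lt_median -?eqm // andbT; lra.
  have := le_right t; rewrite !right_cdf_ge_median -?eqm // => le_t.
  by rewrite cdf_share_ge_median -?eqm //=; lra.
have gsym s : g (1 - s) = g s := two_party_utility_sym _ s.
(* The median and the full cdf determine both half cdfs, so equal full cdfs would make both
   dominance relations equalities. *)
have [t0 neF] : exists t, cdf_share D t != cdf_share D' t.
  apply: contrapT => /forallNP eqF.
  have {}eqF t : cdf_share D t = cdf_share D' t by apply/eqP/negPn/negP/eqF.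
  case: ne_cdf; apply; apply/funext => t; case: (ltP t (median D)) => tm.
  - by rewrite !left_cdf_lt_median -?eqm // eqF.
  - by rewrite !left_cdf_ge_median -?eqm.
  - by rewrite !right_cdf_lt_median -?eqm.
  - by rewrite !right_cdf_ge_median -?eqm // eqF.
apply: (@platform_gap_lt _ _ _ _ t0) => [t|].
  have [/andP[F0 F1] /andP[F0' F1']] := (F01 D t, F01 D' t).
  case: (half t) => -[tm /andP[h1 h2]]; first exact: (two_party_utility_le Hrho HU).
  (* Reflection brings shares above 1/2 into the range where [g] increases. *)
  by rewrite -/g -gsym -[leRHS]gsym; apply: (two_party_utility_le Hrho HU); lra.
have [/andP[F0 F1] /andP[F0' F1']] := (F01 D t0, F01 D' t0).
case: (half t0) => -[tm /andP[h1 h2]].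
  by apply: (two_party_utility_lt Hrho HU) => //; rewrite lt_neqAle neF.
have lt_F : cdf_share D' t0 < cdf_share D t0 by rewrite lt_neqAle eq_sym neF.
by rewrite -/g -gsym -[ltRHS]gsym; apply: (two_party_utility_lt Hrho HU); lra.
Qed.

Theorem proposition3 (R : realType) (rho U : R -> R) (rhobar phi : R)
    (Hrho : power_rule rho rhobar)
    (HU : utility_on (rho 0) (rho 1) U)
    (nu : R -> R) (nuE : nu = U \o rho) (nu_norm : nu 1 - nu 0 = 1)
    (phi_lt : - phi < phi)
    (D D' : voter_dist R)
    (wide : wide_support D phi) (wide' : wide_support D' phi)
    (spread : is_spread (translate D' (median D')) (translate D (median D))) :
  [/\ equilibrium_platforms nu phi_lt D (low_platform nu D) (high_platform nu D),
      equilibrium_platforms nu phi_lt D' (low_platform nu D') (high_platform nu D'),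
      high_platform nu D - low_platform nu D
        < high_platform nu D' - low_platform nu D' &
      forall (p : party) (xA xB xA' xB' : R),
        nash nu phi_lt D xA xB -> nash nu phi_lt D' xA' xB' ->
        payoff nu phi_lt D p xA xB < payoff nu phi_lt D' p xA' xB'].
Proof.
have nu_incr : {in `[0, 1] &, {homo nu : s t / s < t}}.
  by rewrite nuE; exact: utility_power_incr Hrho HU.
have lt_platforms (E : voter_dist R) : low_platform nu E < high_platform nu E.
  rewrite nuE; apply: low_lt_high_platform => s.
    exact: two_party_utility0_le Hrho HU _.
  exact: two_party_utility0_lt Hrho HU _.
have gap : high_platform nu D - low_platform nu D
    < high_platform nu D' - low_platform nu D'.
  (* Both recentred electorates have median 0, and recentring moves the two platforms of an
     electorate equally, leaving its gap unchanged. *)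
  have eqm : median (translate D (median D)) = median (translate D' (median D')).
    by rewrite !median_translate !subrr.
  have := is_spread_platform_gap_lt Hrho HU eqm spread; rewrite -nuE.
  rewrite !high_platform_translate // !low_platform_translate //.
  by rewrite !opprB !addrA !subrK.
split=> //.
- by split=> // xA xB; exact: nashE.
- by split=> // xA xB; exact: nashE.
move=> p xA xB xA' xB' n n'.
rewrite (nash_payoff nu_incr nu_norm wide (lt_platforms D) p n).
rewrite (nash_payoff nu_incr nu_norm wide' (lt_platforms D') p n').
rewrite ltrD2l ltr_pM2r; last by rewrite invr_gt0; lra.
have gap0 : 0 < high_platform nu D - low_platform nu D by rewrite subr_gt0.
by rewrite ltrXn2r ?nnegrE //; lra.
Qed.
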